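(* Let $K\subset\mathbb{R}^n$ be a proper convex cone, $\psi$ an upper semi-continuous concave function on $K$, non-decreasing with respect to $\le_K$, with $\psi(0)=0$. For $t\in[m]$ let $F_t\subset\mathbb{R}^k$ be compact convex and $A_t\in\mathbb{R}^{n\times k}$ with $A_tF_t\subset K$, and let $D^\star$ be the optimal value of the dual problem. Let $\psi_S$ be an upper semi-continuous concave function with $\psi_S(0)=0$ that is differentiable on an open set containing $K$ and satisfies Assumption 1 (see context). Suppose there exists $c\in K$ such that $A_tx\le_K c$ for all $x\in F_t$ and all $t$. Let $\hat x_1,\dots,\hat x_m$ be produced by the sequential update algorithm run with $\psi_S$ in place of $\psi$, and $P_{\rm seq}=\psi(\sum_{t=1}^mA_t\hat x_t)$. Then $$P_{\rm seq}\ge\frac{1}{1-\bar\alpha_{\psi,\psi_S}+\kappa_{c,\psi,\psi_S}}\,D^\star,$$ where $\kappa_{c,\psi,\psi_S}=\inf\{r:\langle c,\nabla\psi_S(0)-\nabla\psi_S(u)\rangle\le r\,\psi(u)\ \forall u\in K\}$.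
   Context: $\psi$ is extended by $-\infty$ outside $K$; $\psi^*(y)=\inf_u\langle y,u\rangle-\psi(u)$; $\partial\psi(u)=\{y:\psi(u')\le\langle y,u'-u\rangle+\psi(u)\ \forall u'\}$. $K^*=\{y:\langle y,u\rangle\ge0\ \forall u\in K\}$; $x\le_Ky$ iff $y-x\in K$, $x\le_{K^*}y$ iff $y-x\in K^*$. $\sigma_t(z)=\sup_{x\in F_t}\langle x,z\rangle$. Offline primal: maximize $\psi(\sum_tA_tx_t)$ over $x_t\in F_t$; dual: minimize $\sum_t\sigma_t(A_t^Ty)-\psi^*(y)$ over $y$, optimal value $D^\star$. Assumption 1 for $\psi_S$: whenever $u\ge_Kv$, there exists $y\in\partial\psi_S(u)$ with $y\le_{K^*}z$ for all $z\in\partial\psi_S(v)$. Sequential update algorithm with $\psi_S$: $\hat y_1=\nabla\psi_S(0)$; for $t=1,\dots,m$: $\hat x_t\in\arg\max_{x\in F_t}\langle x,A_t^T\hat y_t\rangle$ and $\hat y_{t+1}=\nabla\psi_S(\sum_{s=1}^tA_s\hat x_s)$. $\alpha_{\psi,\psi_S}(u)=\sup\{c:\psi^*(y)\ge\psi_S(u)+(c-1)\psi(u)\ \forall y\in\partial\psi_S(u)\}$ and $\bar\alpha_{\psi,\psi_S}=\inf\{\alpha_{\psi,\psi_S}(u):u\in K\}$. *)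

(* Defs.v *)
(* Vectors of R^n are column vectors 'cV[R]_n. *)
From HB Require Export structures.
From mathcomp Require Export all_boot all_order all_algebra.
From mathcomp Require Export all_classical all_reals all_analysis.
Export Order.TTheory GRing.Theory Num.Theory.
Export numFieldNormedType.Exports.

Set Implicit Arguments.
Unset Strict Implicit.
Unset Printing Implicit Defensive.

#[global] Open Scope classical_set_scope.
#[global] Open Scope ring_scope.

Section Euclidean.
Context {R : realType} {n : nat}.
Implicit Types (u v y z : 'cV[R]_n) (K : set 'cV[R]_n).

Definition dotp y u : R := \sum_(i < n) y i 0 * u i 0.

Definition gradient (f : 'cV[R]_n -> R) u : 'cV[R]_n :=
  \col_(i < n) 'D_(delta_mx i 0) f u.

(* Closed, convex, pointed and with nonempty interior. The scaling clause
   includes a = 0, so that K contains the origin. *)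
Definition proper_cone K : Prop :=
  [/\ closed K, convex_set K,
      (forall (a : R) u, 0 <= a -> K u -> K (a *: u)),
      (forall u, K u -> K (- u) -> u = 0)
    & K° !=set0].

Definition dual_cone K : set 'cV[R]_n :=
  [set y | forall u, K u -> 0 <= dotp y u].

Definition cone_le K u v : Prop := K (v - u).

Definition ext K (f : 'cV[R]_n -> R) u : \bar R :=
  if u \in K then (f u)%:E else -oo%E.

(* The weights are kept in the open interval (0, 1), and the definition is used
   only for functions never equal to +oo, so that no 0 * oo or oo - oo occurs. *)
Definition concave (f : 'cV[R]_n -> \bar R) : Prop :=
  forall u v (l : R), 0 < l < 1 ->
    (l%:E * f u + (1 - l)%:E * f v <= f (l *: u + (1 - l) *: v)%R)%E.

Definition upper_semicontinuous (f : 'cV[R]_n -> \bar R) : Prop :=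
  lower_semicontinuous (fun u => - f u)%E.

Definition superdiff (f : 'cV[R]_n -> \bar R) u : set 'cV[R]_n :=
  [set y | forall u', (f u' <= (dotp y (u' - u)%R)%:E + f u)%E].

Definition concave_conj (f : 'cV[R]_n -> \bar R) y : \bar R :=
  ereal_inf [set ((dotp y u)%:E - f u)%E | u in [set: 'cV[R]_n]].

Definition support_fun (F : set 'cV[R]_n) z : \bar R :=
  ereal_sup [set (dotp x z)%:E | x in F].

Definition argmax (F : set 'cV[R]_n) z : set 'cV[R]_n :=
  [set x | F x /\ forall x', F x' -> dotp x' z <= dotp x z].

Definition differentiable_around K (f : 'cV[R]_n -> \bar R) : Prop :=
  exists U : set 'cV[R]_n,
    [/\ open U, K `<=` U,
        (forall u, U u -> f u \is a fin_num)
      & (forall u, U u -> differentiable (fine \o f) u)].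

(* u and v range over K only: f may be -oo elsewhere, where its superdifferential
   is empty. *)
Definition antitone_superdiff K (f : 'cV[R]_n -> \bar R) : Prop :=
  forall u v, K u -> K v -> cone_le K v u ->
    exists2 y, superdiff f u y &
      forall z, superdiff f v z -> cone_le (dual_cone K) y z.

Definition alpha K (psi : 'cV[R]_n -> R) (psiS : 'cV[R]_n -> \bar R) u
  : \bar R :=
  ereal_sup [set a%:E | a in [set a : R |
    forall y, superdiff psiS u y ->
      (psiS u + ((a - 1) * psi u)%R%:E <= concave_conj (ext K psi) y)%E]].

Definition alpha_bar K (psi : 'cV[R]_n -> R) (psiS : 'cV[R]_n -> \bar R)
  : \bar R :=
  ereal_inf [set alpha K psi psiS u | u in K].

Definition kappa K (c : 'cV[R]_n) (psi : 'cV[R]_n -> R)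
    (psiS : 'cV[R]_n -> \bar R) : \bar R :=
  ereal_inf [set r%:E | r in [set r : R |
    forall u, K u ->
      dotp c (gradient (fine \o psiS) 0 - gradient (fine \o psiS) u)
        <= r * psi u]].

End Euclidean.

Section OnlineProblem.
Context {R : realType} {n k m : nat}.
Variables (A : 'I_m -> 'M[R]_(n, k)).

Definition dual_objective (K : set 'cV[R]_n) (psi : 'cV[R]_n -> R)
    (F : 'I_m -> set 'cV[R]_k) (y : 'cV[R]_n) : \bar R :=
  (\sum_(t < m) support_fun (F t) ((A t)^T *m y)%R
   - concave_conj (ext K psi) y)%E.

Definition dual_value (K : set 'cV[R]_n) (psi : 'cV[R]_n -> R)
    (F : 'I_m -> set 'cV[R]_k) : \bar R :=
  ereal_inf [set dual_objective K psi F y | y in [set: 'cV[R]_n]].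

(* Rounds are numbered from 0: round t : 'I_m uses the dual iterate yhat t and
   produces yhat t.+1. The argmax need not be unique, hence a relation. *)
Definition sequential_run (psiS : 'cV[R]_n -> \bar R)
    (F : 'I_m -> set 'cV[R]_k)
    (xhat : 'I_m -> 'cV[R]_k) (yhat : nat -> 'cV[R]_n) : Prop :=
  [/\ yhat 0%N = gradient (fine \o psiS) 0,
      (forall t : 'I_m, argmax (F t) ((A t)^T *m yhat t) (xhat t))
    & (forall t : 'I_m, yhat t.+1 =
         gradient (fine \o psiS) (\sum_(s < m | (s <= t)%N) A s *m xhat s))].

End OnlineProblem.

(* Main.v *)
(** Let u be the final load and take the dual point y, the gradient of psi_S at
    u. Along the run the gradients decrease in the order of K^*, so each support
    value at y is at most <A_t x_t, y_t>, which splits into <A_t x_t, y_(t+1)>,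
    at most the increment of psi_S, and <A_t x_t, y_t - y_(t+1)>, at most the
    same pairing with c in place of A_t x_t. Both telescope, and the definitions
    of alpha and kappa bound the dual objective at y by
    (1 - alpha + kappa) * psi u.

    For the extended-real quotient: a finite alpha_bar forces psi to be positive
    somewhere on K, whence alpha_bar <= 0 <= kappa and the denominator is at
    least 1; if the denominator is infinite, its inverse is 0 or -oo and the
    bound follows from weak duality, which makes the dual value nonnegative. *)
From mathcomp Require Import lra ring.
Require Import Defs.

Set Implicit Arguments.
Unset Strict Implicit.
Unset Printing Implicit Defensive.

(** * Bilinearity of the inner product and the adjoint identity *)

Section DotProduct.
Context {R : realType} {n : nat}.
Implicit Types (u v y z : 'cV[R]_n).

Lemma dotpC y z : dotp y z = dotp z y.
Proof. by apply: eq_bigr => i _; rewrite mulrC. Qed.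

Lemma dotpDr y u v : dotp y (u + v) = dotp y u + dotp y v.
Proof.
by rewrite /dotp -big_split; apply: eq_bigr => i _; rewrite mxE mulrDr.
Qed.

Lemma dotpZr y (a : R) u : dotp y (a *: u) = a * dotp y u.
Proof.
by rewrite /dotp mulr_sumr; apply: eq_bigr => i _; rewrite mxE mulrCA.
Qed.

Lemma dotpNr y u : dotp y (- u) = - dotp y u.
Proof. by rewrite -scaleN1r dotpZr mulN1r. Qed.

Lemma dotpBr y u v : dotp y (u - v) = dotp y u - dotp y v.
Proof. by rewrite dotpDr dotpNr. Qed.

Lemma dotp0r y : dotp y 0 = 0.
Proof. by rewrite -(scale0r y) dotpZr mul0r. Qed.

Lemma dotpBl y z u : dotp (y - z) u = dotp y u - dotp z u.
Proof. by rewrite dotpC dotpBr !(dotpC u). Qed.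

Lemma dotp_sumr y m (f : 'I_m -> 'cV[R]_n) :
  dotp y (\sum_t f t) = \sum_t dotp y (f t).
Proof.
exact: (big_morph (dotp y) (fun u v => dotpDr y u v) (dotp0r y)).
Qed.

Lemma dotp_delta y (i : 'I_n) : dotp y (delta_mx i 0) = y i 0.
Proof.
rewrite /dotp (bigD1 i) //= mxE !eqxx mulr1 big1 ?addr0 // => j ji.
by rewrite mxE (negbTE ji) mulr0.
Qed.

Lemma dotp_trmx k (A : 'M[R]_(n, k)) (x : 'cV[R]_k) y :
  dotp x (A^T *m y) = dotp y (A *m x).
Proof.
rewrite /dotp; under eq_bigr => j _ do rewrite mxE mulr_sumr.
rewrite exchange_big; apply: eq_bigr => i _ /=; rewrite mxE mulr_sumr.
by apply: eq_bigr => j _; rewrite mxE; ring.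
Qed.

End DotProduct.

(** * Closure of a proper cone under finite sums *)

Section ProperCone.
Context {R : realType} {n : nat}.
Implicit Types (K : set 'cV[R]_n).

Lemma proper_cone0 K : proper_cone K -> K 0.
Proof.
move=> [_ _ KZ _ [u /nbhs_singleton Ku]].
by rewrite -(scale0r u); exact: KZ.
Qed.

(** The sum is twice the midpoint, so convexity and scaling suffice. *)
Lemma proper_coneD K u v : proper_cone K -> K u -> K v -> K (u + v).
Proof.
move=> [_ Kconv KZ _ _] Ku Kv.
have h0 : 0 <= (2^-1 : R) by rewrite invr_ge0.
have h1 : (2^-1 : R) <= 1 by rewrite invf_le1 // ler1n.
have /set_mem Kmid := Kconv u v (Itv01 h0 h1) (mem_set Ku) (mem_set Kv).
have -> : u + v = 2 *: (2^-1 *: u + (1 - 2^-1) *: v).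
  rewrite scalerDr !scalerA divff // mulrBr mulr1 divff //.
  by rewrite -[2]/(1 + 1) addrK !scale1r.
by apply: KZ.
Qed.

Lemma proper_cone_sum K m (P : pred 'I_m) (f : 'I_m -> 'cV[R]_n) :
  proper_cone K -> (forall t, K (f t)) -> K (\sum_(t | P t) f t).
Proof.
move=> Kp Kf; elim/big_ind: _ => [|u v Ku Kv|//].
  exact: proper_cone0.
exact: proper_coneD.
Qed.

End ProperCone.

(** * Supergradients at a point of differentiability *)

Section Superdifferential.
Context {R : realType} {n : nat}.

(** A supergradient bounds the derivative in every direction; the directions [delta_mx i 0] and its
    opposite together force equality in each coordinate. *)
Lemma superdiff_gradient (f : 'cV[R]_n -> \bar R) u y :
  (\forall v \near u, f v \is a fin_num) -> differentiable (fine \o f) u ->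
  superdiff f u y -> y = gradient (fine \o f) u.
Proof.
move=> f_fin f_diff fy.
have derive_le v : 'D_v (fine \o f) u <= dotp y v.
  have dv : derivable (fine \o f) u v := diff_derivable f_diff.
  (* The limit is taken from the right because dividing the supergradient inequality by [h] keeps
     its direction only for positive [h]. *)
  have dr := cvg_dnbhs_at_right dv.
  rewrite /derive -(cvg_lim _ dr) //.
  apply: limr_le; first by apply/cvg_ex; exists ('D_v (fine \o f) u).
  have near_line : \forall h \near (0:R)^'+, f (h *: v + u) \is a fin_num.
    have line_cvg : h *: v + u @[h --> (0 : R)^'+] --> u.
      apply: cvg_at_right_filter.
      rewrite -[X in _ --> X]add0r -[X in _ --> X + _](scale0r v).
      apply: cvgD; last exact: cvg_cst.
      by apply: cvgZr_tmp; exact: cvg_id.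
    exact: line_cvg f_fin.
  near=> h.
  have h0 : 0 < h by near: h; exact: nbhs_right_gt.
  have fh : f (h *: v + u) \is a fin_num by near: h.
  have fu : f u \is a fin_num by exact: nbhs_singleton f_fin.
  have := fy (h *: v + u).
  rewrite -(fineK fh) -(fineK fu) -EFinD lee_fin addrK dotpZr => le.
  by rewrite /= /GRing.scale /= ler_pdivrMl //; lra.
apply/colP => i; rewrite mxE -dotp_delta.
apply/le_anti; rewrite derive_le andbT.
by have := derive_le (- delta_mx i 0); rewrite dotpNr !deriveE // linearN lerN2.
Unshelve. all: by end_near.
Qed.
End Superdifferential.

(** * Assumption 1 read as antitonicity of the gradient *)

Section AntitoneSuperdifferential.
Context {R : realType} {n : nat}.
Variables (K : set 'cV[R]_n) (f : 'cV[R]_n -> \bar R).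

Local Notation grad := (gradient (fine \o f)).

Lemma differentiable_around_fin_num u :
  differentiable_around K f -> K u -> f u \is a fin_num.
Proof. by move=> [U [_ KU f_fin _]] Ku; exact/f_fin/KU. Qed.

Lemma differentiable_around_superdiff u y :
  differentiable_around K f -> K u -> superdiff f u y -> y = grad u.
Proof.
move=> [U [Uopen KU f_fin f_diff]] Ku; apply: superdiff_gradient.
  by apply: filterS f_fin _; apply: open_nbhs_nbhs; split=> //; exact: KU.
exact/f_diff/KU.
Qed.

(** Assumption 1 at the pair [u], [u] supplies some supergradient, and differentiability identifies
    it with the gradient. *)
Lemma gradient_superdiff u :
  proper_cone K -> differentiable_around K f -> antitone_superdiff K f ->
  K u -> superdiff f u (grad u).
Proof.
move=> Kp fd fa Ku; have [|y fy _] := fa u u Ku Ku.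
  by rewrite /cone_le subrr; exact: proper_cone0.
by rewrite -(differentiable_around_superdiff fd Ku fy).
Qed.

Lemma gradient_antitone u v w :
  proper_cone K -> differentiable_around K f -> antitone_superdiff K f ->
  K u -> K v -> K w -> K (v - u) -> dotp (grad v) w <= dotp (grad u) w.
Proof.
move=> Kp fd fa Ku Kv Kw uv; have [y fy /(_ (grad u))] := fa v u Kv Ku uv.
rewrite (differentiable_around_superdiff fd Kv fy).
move=> /(_ (gradient_superdiff Kp fd fa Ku)) /(_ w Kw).
by rewrite dotpBl subr_ge0.
Qed.

Lemma superdiff_fine u v y : f u \is a fin_num -> f v \is a fin_num ->
  superdiff f u y -> dotp y (u - v) <= fine (f u) - fine (f v).
Proof.
move=> fu fv /(_ v); rewrite -(fineK fu) -(fineK fv) -EFinD lee_fin /=.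
by rewrite !dotpBr; lra.
Qed.

End AntitoneSuperdifferential.

(** * Weak duality for the offline problem *)

Section WeakDuality.
Context {R : realType} {n k m : nat}.
Variables (A : 'I_m -> 'M[R]_(n, k)) (K : set 'cV[R]_n) (psi : 'cV[R]_n -> R).
Variables (F : 'I_m -> set 'cV[R]_k).

Lemma concave_conj_le y u : K u ->
  (concave_conj (ext K psi) y <= (dotp y u - psi u)%:E)%E.
Proof.
by move=> Ku; apply: ereal_inf_lbound; exists u => //; rewrite /ext mem_set.
Qed.

Lemma dual_value_ge (x : 'I_m -> 'cV[R]_k) : (forall t, F t (x t)) ->
  K (\sum_t A t *m x t) ->
  ((psi (\sum_t A t *m x t))%:E <= dual_value A K psi F)%E.
Proof.
set u := \sum_t _ => Fx Ku; apply/ereal_infP => _ [y _ <-].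
(* In this form [psi u] compares with the dual objective term by term: each pairing with a support
   value, the last term with the conjugate. *)
have -> : (psi u)%:E =
    (\sum_t (dotp y (A t *m x t))%:E - (dotp y u - psi u)%:E)%E.
  by rewrite sumEFin -dotp_sumr -EFinB; congr EFin; rewrite -/u; lra.
apply: leeB; last exact: concave_conj_le.
apply: lee_sum => t _; apply: ereal_sup_ubound; exists (x t) => //.
by rewrite dotp_trmx.
Qed.

End WeakDuality.

(** * Degenerate values and signs of alpha and kappa *)

Section Ratios.
Context {R : realType} {n : nat}.
Variables (K : set 'cV[R]_n) (psi : 'cV[R]_n -> R) (psiS : 'cV[R]_n -> \bar R).
Variable (c : 'cV[R]_n).

Local Notation grad := (gradient (fine \o psiS)).

(** With [psi u = 0] the constant disappears from the defining inequality, so one admissible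
    constant makes every real admissible. *)
Lemma alpha_psi_eq0 u (a : R) : psi u = 0 ->
  (a%:E < alpha K psi psiS u)%E -> alpha K psi psiS u = +oo%E.
Proof.
move=> psiu /ereal_sup_gt[_ [b /= b_ok <-] _]; apply/eqyP => r r0.
apply: ereal_sup_ubound; exists r => //= y /b_ok.
by rewrite psiu !mulr0.
Qed.

(** The conjugate at [grad u], tested at [u], is at most [dotp (grad u) u - psi u], and the
    supergradient inequality against the origin bounds that pairing by [psiS u]. An admissible [a]
    thus satisfies [a * psi u <= 0]. *)
Lemma alpha_le0 u : psi 0 = 0 -> psiS 0 = 0%E -> K u -> 0 < psi u ->
  psiS u \is a fin_num -> superdiff psiS u (grad u) ->
  (alpha K psi psiS u <= 0)%E.
Proof.
move=> psi0 psiS0 Ku psiu psiSu gu; apply/ereal_supP => _ [a /= a_ok <-].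
have psiS0fin : psiS 0 \is a fin_num by rewrite psiS0.
have := superdiff_fine psiSu psiS0fin gu; rewrite psiS0 /= !subr0 => dot_le.
have := le_trans (a_ok _ gu) (concave_conj_le psi (grad u) Ku).
rewrite -(fineK psiSu) -EFinD !lee_fin => le.
rewrite -(pmulr_lle0 _ psiu); lra.
Qed.

Lemma kappa_ge0 u : K u -> 0 < psi u -> dotp c (grad u) <= dotp c (grad 0) ->
  (0 <= kappa K c psi psiS)%E.
Proof.
move=> Ku psiu cu; apply/ereal_infP => _ [r /= r_ok <-]; have := r_ok u Ku.
by rewrite dotpBr lee_fin -(pmulr_lge0 _ psiu); lra.
Qed.

End Ratios.

(** * Telescoping analysis of the sequential algorithm *)

Section SequentialRun.
Context {R : realType} {n k m : nat}.
Variables (K : set 'cV[R]_n) (psi : 'cV[R]_n -> R).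
Variables (F : 'I_m -> set 'cV[R]_k) (A : 'I_m -> 'M[R]_(n, k)).
Variables (psiS : 'cV[R]_n -> \bar R) (c : 'cV[R]_n).
Variables (xhat : 'I_m -> 'cV[R]_k) (yhat : nat -> 'cV[R]_n).

Local Notation grad := (gradient (fine \o psiS)).
Local Notation load := (\sum_t A t *m xhat t).

Definition partial_load (t : nat) : 'cV[R]_n :=
  \sum_(s < m | (s < t)%N) A s *m xhat s.

Lemma partial_load_full : partial_load m = load.
Proof. by apply: eq_bigl => s; rewrite ltn_ord. Qed.

Lemma partial_load_split (t : nat) :
  load - partial_load t = \sum_(s < m | ~~ (s < t)%N) A s *m xhat s.
Proof.
rewrite /partial_load (bigID (fun s : 'I_m => (s < t)%N)) /=.
by rewrite [X in X - _]addrC addrK.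
Qed.

Lemma partial_load_succ (t : 'I_m) :
  partial_load t.+1 = partial_load t + A t *m xhat t.
Proof.
rewrite /partial_load (bigD1 t) //= addrC; congr (_ + _).
by apply: eq_bigl => s; rewrite ltnS andbC -ltn_neqAle.
Qed.

Lemma sequential_run_gradient t : sequential_run A psiS F xhat yhat ->
  (t <= m)%N -> yhat t = grad (partial_load t).
Proof.
(* The update after round [t] sums over [s <= t], which is [s < t.+1] by computation. *)
move=> [y0 _ yS]; case: t => [|t] tm; last exact: (yS (Ordinal tm)).
by rewrite y0 /partial_load big_pred0.
Qed.

(* Each round gains at most the increment of psiS plus a price drop that c
   dominates, and both telescope. *)
Lemma sequential_run_support_le :
  proper_cone K -> psiS 0 = 0%E -> differentiable_around K psiS ->
  antitone_superdiff K psiS ->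
  (forall t x, F t x -> K (A t *m x)) ->
  (forall t x, F t x -> cone_le K (A t *m x) c) ->
  sequential_run A psiS F xhat yhat ->
  (\sum_t support_fun (F t) ((A t)^T *m grad load)
     <= (fine (psiS load) + dotp c (grad 0 - grad load))%:E)%E.
Proof.
move=> Kp psiS0 psiS_diff psiS_anti AFK AFc run; set u := load.
have Fx t : F t (xhat t) by case: run => _ /(_ t)[].
have KA t : K (A t *m xhat t) by exact: AFK.
have KL t : K (partial_load t) by exact: proper_cone_sum.
have Ku : K u by exact: proper_cone_sum.
have yE t := @sequential_run_gradient t run.
have fin v := @differentiable_around_fin_num _ _ K psiS v psiS_diff.
have sup v := @gradient_superdiff _ _ K psiS v Kp psiS_diff psiS_anti.
have anti v w z := @gradient_antitone _ _ K psiS v w z Kp psiS_diff psiS_anti.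
(* Potential whose increment will bound the support value of round [t]. *)
pose G t := fine (psiS (partial_load t)) - dotp c (grad (partial_load t)).
have round (t : 'I_m) :
    (support_fun (F t) ((A t)^T *m grad u) <= (G t.+1 - G t)%:E)%E.
  apply/ereal_supP => _ [x Fxt <-]; rewrite lee_fin dotp_trmx.
  have [_ /(_ t)[_ /(_ x Fxt)]] := run.
  rewrite !dotp_trmx (yE t (ltnW (ltn_ord t))) => opt _.
  (* The final load dominates every partial load, so moving from [grad u] to the current price only
     raises the pairing; there [xhat t] is optimal. *)
  have mono :
      dotp (grad u) (A t *m x) <= dotp (grad (partial_load t)) (A t *m x).
    apply: anti => //; first exact: AFK.
    by rewrite partial_load_split; exact: proper_cone_sum.
  (* Pairing the price drop with the cone element [c - A t *m xhat t] replaces the load of the round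
     by [c]. *)
  have drop := anti (partial_load t) (partial_load t.+1) (c - A t *m xhat t)
    (KL _) (KL _) (AFc _ _ (Fx t)).
  rewrite {1}partial_load_succ [X in K X]addrAC subrr add0r in drop.
  have {drop} := drop (KA t); rewrite !dotpBr => drop.
  (* The supergradient is taken at the new load and tested at the old one, hence the price after the
     update. *)
  have := superdiff_fine (fin _ (KL t.+1)) (fin _ (KL t)) (sup _ (KL t.+1)).
  rewrite {2}partial_load_succ [X in dotp _ X]addrAC subrr add0r => gain.
  rewrite /G !(dotpC c); lra.
apply: (le_trans (lee_sum _ (fun t _ => round t))).
rewrite sumEFin lee_fin -(big_mkord xpredT (fun t => G t.+1 - G t)).
rewrite telescope_sumr // /G partial_load_full -/u.
have -> : partial_load 0 = 0 by rewrite /partial_load big_pred0.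
by rewrite psiS0 dotpBr /=; lra.
Qed.

(** Real constants admissible at the final load alone keep the estimate free of extended arithmetic;
    they later approximate [alpha_bar] and [kappa]. *)
Lemma sequential_run_dual_value_le (a r : R) :
  proper_cone K -> psiS 0 = 0%E -> differentiable_around K psiS ->
  antitone_superdiff K psiS ->
  (forall t x, F t x -> K (A t *m x)) ->
  (forall t x, F t x -> cone_le K (A t *m x) c) ->
  sequential_run A psiS F xhat yhat ->
  (forall y, superdiff psiS load y ->
     (psiS load + ((a - 1) * psi load)%:E <= concave_conj (ext K psi) y)%E) ->
  dotp c (grad 0 - grad load) <= r * psi load ->
  (dual_value A K psi F <= ((1 - a + r) * psi load)%:E)%E.
Proof.
move=> Kp psiS0 psiS_diff psiS_anti AFK AFc run; set u := load => a_ok r_ok.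
have Ku : K u.
  by apply: proper_cone_sum => // t; apply: AFK; case: run => _ /(_ t)[].
have psiSu := differentiable_around_fin_num psiS_diff Ku.
have := a_ok _ (gradient_superdiff Kp psiS_diff psiS_anti Ku).
rewrite -(fineK psiSu) -EFinD => conj_ge.
apply: (@le_trans _ _ (dual_objective A K psi F (grad u))).
  by apply: ereal_inf_lbound; exists (grad u).
have sup_le :=
  sequential_run_support_le Kp psiS0 psiS_diff psiS_anti AFK AFc run.
apply: (le_trans (leeB sup_le conj_ge)).
by rewrite -/u -EFinB lee_fin; lra.
Qed.

End SequentialRun.

(** * The competitive ratio as an extended-real inequality *)

Theorem theorem3 (R : realType) (n k m : nat)
  (K : set 'cV[R]_n) (psi : 'cV[R]_n -> R)
  (F : 'I_m -> set 'cV[R]_k) (A : 'I_m -> 'M[R]_(n, k))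
  (psiS : 'cV[R]_n -> \bar R) (c : 'cV[R]_n)
  (xhat : 'I_m -> 'cV[R]_k) (yhat : nat -> 'cV[R]_n)
  (K_proper : proper_cone K)
  (psi_usc : upper_semicontinuous (ext K psi))
  (psi_concave : concave (ext K psi))
  (psi_nondecreasing :
     forall u v, K u -> K v -> cone_le K u v -> psi u <= psi v)
  (psi0 : psi 0 = 0)
  (F_compact : forall t, compact (F t))
  (F_convex : forall t, convex_set (F t))
  (AF_K : forall t x, F t x -> K (A t *m x))
  (psiS_lty : forall u, (psiS u < +oo)%E)
  (psiS_usc : upper_semicontinuous psiS)
  (psiS_concave : concave psiS)
  (psiS0 : psiS 0 = 0%E)
  (psiS_diff : differentiable_around K psiS)
  (psiS_assumption1 : antitone_superdiff K psiS)
  (c_K : K c)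
  (AF_le_c : forall t x, F t x -> cone_le K (A t *m x) c)
  (run : sequential_run A psiS F xhat yhat) :
  ((1 - alpha_bar K psi psiS + kappa K c psi psiS)^-1 * dual_value A K psi F
     <= (psi (\sum_(t < m) A t *m xhat t)%R)%:E)%E.
Proof.
pose u := \sum_t A t *m xhat t; rewrite -/u.
have Fx t : F t (xhat t) by case: run => _ /(_ t)[].
have Ku : K u by apply: proper_cone_sum => // t; exact: AF_K.
have K0 := proper_cone0 K_proper.
have psi_ge0 v : K v -> 0 <= psi v.
  by move=> Kv; rewrite -psi0; apply: psi_nondecreasing; rewrite /cone_le ?subr0.
have D_ge0 : (0 <= dual_value A K psi F)%E.
  apply: (@le_trans _ _ (psi u)%:E); last exact: dual_value_ge.
  by rewrite lee_fin; exact: psi_ge0.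
have D_le a r := @sequential_run_dual_value_le _ _ _ _ K psi F A psiS c xhat
  yhat a r K_proper psiS0 psiS_diff psiS_assumption1 AF_K AF_le_c run.
have P_ge0 : (0 <= (psi u)%:E)%E by rewrite lee_fin psi_ge0.
set S := (_ + kappa _ _ _ _)%E.
have [S_fin|] := boolP (S \is a fin_num); last first.
  rewrite fin_numE negb_and !negbK => /orP[]/eqP->.
    by rewrite inveNy; apply: le_trans P_ge0; apply: mule_le0_ge0; rewrite ?leNye.
  by rewrite invey mul0e.
have [b_fin k_fin] :
    alpha_bar K psi psiS \is a fin_num /\ kappa K c psi psiS \is a fin_num.
  by move: S_fin; rewrite /S fin_numD fin_numB => /andP[/andP[_ ->] ->].
move: S_fin; rewrite /S; move: (fineK b_fin) (fineK k_fin).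
set b := fine _; set q := fine _ => bE qE _; rewrite -bE -qE -EFinB -EFinD.
have alpha_gt v (e : R) : K v -> 0 < e -> ((b - e)%:E < alpha K psi psiS v)%E.
  move=> Kv e0; apply: (@lt_le_trans _ _ b%:E); first by rewrite lte_fin; lra.
  by rewrite bE; apply: ereal_inf_lbound; exists v.
(* A finite infimum gives a point [v] where alpha is below [+oo]; [psi v = 0] would make it [+oo]
   there. *)
have [v Kv psiv] : exists2 v, K v & 0 < psi v.
  have /ereal_inf_lt[_ [v Kv <-] av] : (alpha_bar K psi psiS < +oo)%E.
    by rewrite -bE ltry.
  exists v => //; rewrite lt_def psi_ge0 // andbT; apply/eqP => psiv0.
  by move: av; rewrite (alpha_psi_eq0 psiv0 (alpha_gt v 1 Kv ltr01)) ltxx.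
have b_le0 : b <= 0.
  rewrite -lee_fin bE; apply: (@le_trans _ _ (alpha K psi psiS v)).
    by apply: ereal_inf_lbound; exists v.
  apply: alpha_le0 => //; first exact: (differentiable_around_fin_num psiS_diff).
  exact: (gradient_superdiff K_proper).
have q_ge0 : 0 <= q.
  rewrite -lee_fin qE; apply: (kappa_ge0 Kv psiv); rewrite !(dotpC c).
  by apply: (gradient_antitone K_proper psiS_diff psiS_assumption1); rewrite ?subr0.
have s_gt0 : 0 < 1 - b + q by lra.
(* The supremum and infimum need not be attained: approximating each within [e] costs [e + e] in the
   factor. *)
have D_le_eps (e : R) : 0 < e ->
    (dual_value A K psi F <= ((1 - b + q + (e + e)) * psi u)%:E)%E.
  move=> e0.
  have /ereal_sup_gt[_ [a /= a_ok <-]] := alpha_gt u e Ku e0; rewrite lte_fin => ba.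
  have /ereal_inf_lt[_ [r /= r_ok <-]] : (kappa K c psi psiS < (q + e)%:E)%E.
    by rewrite -qE lte_fin; lra.
  rewrite lte_fin => rq; apply: (le_trans (D_le a r a_ok (r_ok u Ku))).
  by rewrite lee_fin; apply: ler_wpM2r; [exact: psi_ge0|lra].
have D_fin : dual_value A K psi F \is a fin_num.
  by rewrite ge0_fin_numE //; exact: le_lt_trans (D_le_eps 1 ltr01) (ltry _).
rewrite -(fineK D_fin) inver (gt_eqF s_gt0) -EFinM lee_fin ler_pdivrMl //.
apply/ler_addgt0Pr => e e0.
(* With [d = e / (2 * psi u + 1)] the excess [(d + d) * psi u] is at most [e]; the added 1 covers
   [psi u = 0]. *)
have P1 : 0 < 2 * psi u + 1 by have := psi_ge0 u Ku; lra.
have d0 := divr_gt0 e0 P1; have dE := divfK (lt0r_neq0 P1) e.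
move: d0 dE; set d := e / _ => d0 dE.
have := D_le_eps d d0; rewrite -(fineK D_fin) lee_fin => /le_trans; apply.
by rewrite mulrDl lerD2l -dE; lra.
Qed.
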